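(* For every positive integer $n$ divisible by twelve, there exists a planar 4-regular Hamiltonian graph on $n$ vertices which is 4-star colourable.
   Context: A $k$-star colouring of a graph is a proper vertex colouring with $k$ colours in which no path on 4 vertices receives only two colours. *)

(* Defs.v *)
From mathcomp Require Import all_boot all_order all_algebra.
From mathcomp Require Import all_classical all_reals all_analysis.
Import numFieldNormedType.Exports.

Set Implicit Arguments.
Unset Strict Implicit.
Unset Printing Implicit Defensive.

Record sgraph := SGraph {
  vertex :> finType;
  edge : rel vertex;
  edge_sym : symmetric edge;
  edge_irr : irreflexive edge
}.

Definition regular (k : nat) (G : sgraph) : Prop :=
  forall v : G, #|[pred w | edge v w]| = k.

Definition hamiltonian (G : sgraph) : Prop :=
  exists c : seq G,
    [/\ 3 <= size c, ucycle (@edge G) c & forall v : G, v \in c].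

Definition proper_colouring (k : nat) (G : sgraph) (c : G -> 'I_k) : Prop :=
  forall u v : G, edge u v -> c u != c v.

(* The path on four vertices need not be induced. *)
Definition star_colouring (k : nat) (G : sgraph) (c : G -> 'I_k) : Prop :=
  proper_colouring c /\
  forall (v : G) (p : seq G),
    size (v :: p) = 4 -> path (@edge G) v p -> uniq (v :: p) ->
    2 < size (undup (map c (v :: p))).

Definition star_colourable (k : nat) (G : sgraph) : Prop :=
  exists c : G -> 'I_k, star_colouring c.

Section Planarity.
Variable R : realType.
Local Open Scope classical_set_scope.
Local Open Scope ring_scope.

Definition simple_arc (a b : R * R) (A : set (R * R)) : Prop :=
  exists f : R -> R * R,
    [/\ {within `[0, 1], continuous f},
        {in `[0, 1] &, injective f},
        f 0 = a, f 1 = b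
      & A = f @` `[0, 1]].

(* [arc u v] is only constrained when [u] and [v] are adjacent; the two
   orientations of an edge are drawn as the same subset of the plane. *)
Record plane_drawing (G : sgraph) (pos : G -> R * R)
    (arc : G -> G -> set (R * R)) : Prop := PlaneDrawing {
  pos_inj : injective pos;
  arc_simple : forall u v, edge u v -> simple_arc (pos u) (pos v) (arc u v);
  arc_sym : forall u v, edge u v -> arc u v = arc v u;
  arc_vertex : forall u v w,
    edge u v -> arc u v (pos w) -> w = u \/ w = v;
  arc_disjoint : forall u v x y,
    edge u v -> edge x y ->
    ~ ((u = x /\ v = y) \/ (u = y /\ v = x)) ->
    (arc u v `\` [set pos u; pos v]) `&` arc x y = set0
}.

Definition planar (G : sgraph) : Prop :=
  exists (pos : G -> R * R) (arc : G -> G -> set (R * R)),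
    plane_drawing pos arc.

End Planarity.

(* Main.v *)
(* The graphs are the cyclic covers of the cuboctahedron obtained by cutting one
   edge [xy] in [t] disjoint copies and joining the copies in a ring along the
   cut edges.  Covers preserve regularity and star colourings: a path on four
   vertices projects to such a path or to a triangle.  If [xy] lies on a
   Hamiltonian cycle, these cycles splice into one.  For planarity, draw each
   copy with [x] and [y] at its bottom corners, place the copies side by side,
   and pull the first [x] and the last [y] slightly down, so that the edge
   closing the ring runs straight below everything else. *)
Require Import Defs.
From mathcomp Require Import all_boot all_order all_algebra.
From mathcomp Require Import all_classical all_reals all_analysis.
From mathcomp Require Import zify ring lra.
Import Order.TTheory GRing.Theory Num.Theory numFieldNormedType.Exports.

Set Implicit Arguments.
Unset Strict Implicit.
Unset Printing Implicit Defensive.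

Local Open Scope ring_scope.

(** * Covers of graphs given by voltages *)

(** In topological graph theory this is the derived graph of the voltage assignment [f]; the second
    component is the covering projection. *)
Definition voltage_edge (A : finZmodType) (G : sgraph) (f : G -> G -> A) :
  rel (A * G) := fun u v => edge u.2 v.2 && (v.1 == u.1 + f u.2 v.2).

Lemma voltage_edge_sym (A : finZmodType) (G : sgraph) (f : G -> G -> A) :
  (forall a b, f b a = - f a b) -> symmetric (voltage_edge f).
Proof.
move=> fN [i a] [j b]; rewrite /voltage_edge /= edge_sym fN.
by congr andb; rewrite [LHS]eq_sym subr_eq.
Qed.

Lemma voltage_edge_irr (A : finZmodType) (G : sgraph) (f : G -> G -> A) :
  irreflexive (voltage_edge f).
Proof. by move=> [i a]; rewrite /voltage_edge /= edge_irr. Qed.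

Definition voltage_graph (A : finZmodType) (G : sgraph) (f : G -> G -> A)
    (fN : forall a b, f b a = - f a b) : sgraph :=
  SGraph (voltage_edge_sym fN) (voltage_edge_irr f).

(** The projection is bijective on neighbourhoods: [b] adjacent to [a] lifts uniquely to the
    neighbour [(i + f a b, b)] of [(i, a)]. *)
Lemma voltage_regular (A : finZmodType) (G : sgraph) (f : G -> G -> A)
    (fN : forall a b, f b a = - f a b) (k : nat) :
  regular k G -> regular k (voltage_graph fN).
Proof.
move=> regG [i a]; rewrite -(regG a).
have inj : injective (fun b : G => (i + f a b, b)) by move=> b c [].
rewrite -(fintype.card_image inj); apply: eq_card => -[j b]; rewrite !inE.
apply/idP/fintype.imageP => [/andP[/= ab /eqP ->]|[c]]; first by exists b.
by rewrite inE => ac [-> ->]; apply/andP; split.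
Qed.

Lemma voltage_star_colourable (A : finZmodType) (G : sgraph) (f : G -> G -> A)
    (fN : forall a b, f b a = - f a b) (k : nat) :
  star_colourable k G -> star_colourable k (voltage_graph fN).
Proof.
move=> [c [propc starc]]; exists (fun u => c u.2); split=> [u v /andP[uv _]|].
  exact: propc.
move=> [i0 a0] [|[i1 a1] [|[i2 a2] [|[i3 a3] []]]] //= _.
rewrite /voltage_edge /= andbT => /and3P[].
case/andP=> a01 /eqP i1E /andP[a12 /eqP i2E] /andP[a23 /eqP i3E] uni.
(* The projected walk never backtracks: the voltages of the two directions of an edge cancel, so the
   lifted path would repeat a vertex. *)
have n02 : a0 != a2.
  apply: contraTneq uni => a02; subst a2.
  by rewrite i2E i1E (fN a0 a1) addrK !inE eqxx orbT.
have n13 : a1 != a3.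
  apply: contraTneq uni => a13; subst a3.
  by rewrite i3E i2E (fN a1 a2) addrK !inE eqxx orbT /= andbF.
have [a03|n03] := eqVneq a0 a3.
  (* The projected walk closes up to a triangle. *)
  subst a3; move: (propc _ _ a01) (propc _ _ a12) (propc _ _ a23).
  rewrite /= !inE => /negPf c01 /negPf c12 /negPf c23.
  by rewrite eqxx !orbT c12 c23 eq_sym c01.
apply: (starc a0 [:: a1; a2; a3]) => //=; first by rewrite a01 a12 a23.
rewrite !inE !negb_or n02 n03 n13 !andbT.
apply/and3P; split; apply/eqP => aE; subst.
- by rewrite edge_irr in a01.
- by rewrite edge_irr in a12.
- by rewrite edge_irr in a23.
Qed.

(** Allows a cycle to be given as a closed walk indexed by [nat], its closing edge being just the
    step that reaches index [n]. *)
Lemma cycle_mkseq (T : Type) (e : rel T) (g : nat -> T) (n : nat) :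
  (forall k, e (g k) (g k.+1)) -> g n = g 0%N -> cycle e (mkseq g n).
Proof.
have pathg m k : (forall k, e (g k) (g k.+1)) ->
    path e (g m) [seq g i | i <- iota m.+1 k].
  by move=> eg; elim: k m => //= k IH m; rewrite eg IH.
case: n => [|n] eg gn //; rewrite /mkseq /= -gn -map_rcons.
have -> : rcons (iota 1 n) n.+1 = iota 1 n.+1.
  by rewrite -cats1 -[in RHS](addn1 n) iotaD.
by rewrite gn; apply: pathg.
Qed.

(** * Straight-line drawings certified by separating lines *)

Definition linval (a b c : int) (p : int * int) : int := a * p.1 + b * p.2 + c.

(* Some line weakly separates the segment [u v] from [x y] and meets one of
   the two in at most an endpoint of [u v]. *)
Definition line_separated (u v x y : int * int) : Prop :=
  exists a b c,
    [/\ 0 <= linval a b c u, 0 <= linval a b c v,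
        linval a b c x <= 0, linval a b c y <= 0
      & [\/ 0 < linval a b c u, 0 < linval a b c v
        | linval a b c x < 0 /\ linval a b c y < 0]].

Definition lineto (R : realType) (p q : R * R) (s : R) : R * R :=
  ((1 - s) * p.1 + s * q.1, (1 - s) * p.2 + s * q.2).

Definition segment (R : realType) (p q : R * R) : set (R * R) :=
  (lineto p q @` `[0, 1]%classic)%classic.

Lemma simple_arc_segment (R : realType) (p q : R * R) :
  p != q -> simple_arc p q (segment p q).
Proof.
move=> pq; exists (lineto p q); split => //.
- apply: continuous_subspaceT => s.
  have cvg_comb (a b : R) : ((fun s => (1 - s) * a + s * b) @ s -->
      (1 - s) * a + s * b)%classic.
    apply: cvgD; apply: cvgM; try exact: cvg_cst; last exact: cvg_id.
    by apply: cvgB; [exact: cvg_cst | exact: cvg_id].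
  apply: (@cvg_pair _ _ _ _ (nbhs ((1 - s) * p.1 + s * q.1))
    (nbhs ((1 - s) * p.2 + s * q.2))); exact: cvg_comb.
- move=> s s' _ _ [e1 e2]; apply/eqP; rewrite -subr_eq0; apply/eqP.
  (* Equality of the two points says that $(s - s')(p - q) = 0$ in each coordinate. *)
  apply: contra_neq_eq pq => ss'.
  case: p q e1 e2 => [p1 p2] [q1 q2] /= e1 e2; congr pair; apply/eqP.
    rewrite -subr_eq0 -(mulrI_eq0 _ (lregP ss')); apply/eqP; lra.
  rewrite -subr_eq0 -(mulrI_eq0 _ (lregP ss')); apply/eqP; lra.
- by rewrite /lineto; case: p {pq} => p1 p2 /=; congr pair; ring.
- by rewrite /lineto; case: q {pq} => q1 q2 /=; congr pair; ring.
Qed.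

Lemma segmentC (R : realType) (p q : R * R) : segment p q = segment q p.
Proof.
have sub (p' q' : R * R) : (segment p' q' `<=` segment q' p')%classic.
  move=> _ [s /= /andP[s0 s1] <-]; exists (1 - s).
    by rewrite /= in_itv /=; move: s0 s1; rewrite !bnd_simp => s0 s1; lra.
  by rewrite /lineto; congr pair; ring.
by apply/seteqP; split; apply: sub.
Qed.

(** Vertices are placed at integer points, so that separation is decided by computation in [int],
    whatever [R] is. *)
Definition intpt (R : realType) (p : int * int) : R * R :=
  (p.1%:~R, p.2%:~R).

(** At a common point, the affine form of the line is a convex combination of values $\ge 0$ and
    also one of values $\le 0$. In the interior of the first segment both of its weights are
    positive, so each of the three strict cases is contradictory. *)
Lemma line_separated_segments (R : realType) (u v x y : int * int) (p : R * R) :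
  line_separated u v x y -> segment (intpt R u) (intpt R v) p ->
  segment (intpt R x) (intpt R y) p -> p = intpt R u \/ p = intpt R v.
Proof.
move=> [a [b [c [Lu Lv Lx Ly str]]]] [s /= + pE] [s' /= + pE'].
rewrite !in_itv /= => /andP[s0 s1] /andP[s'0 s'1].
have [sE|sn0] := eqVneq s 0.
  by left; rewrite -pE sE /lineto /=; congr pair; ring.
have [sE|sn1] := eqVneq s 1.
  by right; rewrite -pE sE /lineto /=; congr pair; ring.
exfalso.
have {}s0 : 0 < s by rewrite lt_neqAle eq_sym sn0.
have {}s1 : s < 1 by rewrite lt_neqAle sn1.
pose L (q : int * int) : R := (linval a b c q)%:~R.
have LE q : L q = a%:~R * (intpt R q).1 + b%:~R * (intpt R q).2 + c%:~R.
  by rewrite /L /linval !rmorphD !rmorphM.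
have e : (1 - s) * L u + s * L v = (1 - s') * L x + s' * L y.
  move: pE'; rewrite -pE /lineto => -[e1 e2]; rewrite !LE.
  transitivity (a%:~R * ((1 - s) * (intpt R u).1 + s * (intpt R v).1) +
    b%:~R * ((1 - s) * (intpt R u).2 + s * (intpt R v).2) + c%:~R); first ring.
  by rewrite /= -e1 -e2; ring.
have Lu' : 0 <= L u by rewrite ler0z.
have Lv' : 0 <= L v by rewrite ler0z.
have Lx' : L x <= 0 by rewrite lerz0.
have Ly' : L y <= 0 by rewrite lerz0.
have tu : 0 <= (1 - s) * L u by rewrite mulr_ge0// subr_ge0 ltW.
have tv : 0 <= s * L v by rewrite mulr_ge0// ltW.
have tx : (1 - s') * L x <= 0 by rewrite mulr_ge0_le0// subr_ge0.
have ty : s' * L y <= 0 by rewrite mulr_ge0_le0.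
case: str => [h|h|[hx hy]].
- have : 0 < (1 - s) * L u by rewrite mulr_gt0 ?subr_gt0 ?ltr0z.
  lra.
- have : 0 < s * L v by rewrite mulr_gt0 ?ltr0z.
  lra.
- have [s'E|s'n0] := eqVneq s' 0.
    have : L x < 0 by rewrite ltrz0.
    move: e tu tv; rewrite s'E; lra.
  have : s' * L y < 0.
    by rewrite pmulr_rlt0 ?ltrz0// lt_neqAle eq_sym s'n0.
  lra.
Qed.

(** Separation of edges also keeps vertices off foreign edges: a vertex on an edge is seen as an
    endpoint of some edge of its own, which exists as no vertex is isolated. *)
Lemma straight_line_planar (R : realType) (G : sgraph) (pos : G -> int * int) :
  injective pos -> (forall u : G, exists v, edge u v) ->
  (forall u v x y : G, edge u v -> edge x y ->
     ~ ((u = x /\ v = y) \/ (u = y /\ v = x)) ->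
     line_separated (pos u) (pos v) (pos x) (pos y)) ->
  planar R G.
Proof.
move=> posI noiso sep; pose rpos u := intpt R (pos u).
have rposI : injective rpos.
  move=> u v [/intr_inj e1 /intr_inj e2]; apply: posI.
  by rewrite (surjective_pairing (pos u)) e1 e2 -surjective_pairing.
have endl (p q : R * R) : segment p q p.
  exists 0; first by rewrite /= in_itv /= lexx ler01.
  by rewrite /lineto; case: p => p1 p2 /=; congr pair; ring.
exists rpos, (fun u v => segment (rpos u) (rpos v)); split => //.
- move=> u v uv; apply: simple_arc_segment.
  by apply: contraTneq uv => /rposI ->; rewrite edge_irr.
- by move=> u v _; apply: segmentC.
- move=> u v w uv wuv; have [x wx] := noiso w.
  have [->|nu] := eqVneq w u; first by left.
  have [->|nv] := eqVneq w v; first by right.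
  have nsame : ~ ((u = w /\ v = x) \/ (u = x /\ v = w)).
    by case=> -[e1 e2]; [rewrite e1 eqxx in nu|rewrite e2 eqxx in nv].
  have := line_separated_segments (sep _ _ _ _ uv wx nsame) wuv (endl _ _).
  by case=> /rposI ->; [left|right].
- move=> u v x y uv xy nsame; rewrite -subset0 => p [[puv npuv] pxy].
  exact: npuv (line_separated_segments (sep _ _ _ _ uv xy nsame) puv pxy).
Qed.

(** * The cuboctahedron and its cyclic covers *)

(* The cuboctahedron, labelled along a Hamiltonian cycle. *)
Definition cubo_adj : seq (seq nat) :=
  [:: [:: 1; 3; 4; 11]; [:: 0; 2; 9; 11]; [:: 1; 3; 7; 9]; [:: 0; 2; 4; 7];
      [:: 0; 3; 5; 6]; [:: 4; 6; 10; 11]; [:: 4; 5; 7; 8]; [:: 2; 3; 6; 8];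
      [:: 6; 7; 9; 10]; [:: 1; 2; 8; 10]; [:: 5; 8; 9; 11]; [:: 0; 1; 5; 10]]%N.

Definition cubo_edge (a b : nat) : bool := b \in nth [::] cubo_adj a.

(** The cut edge is the one that closes the Hamiltonian cycle [0, 1, ..., 11]. *)
Definition inner_edge (a b : nat) : bool :=
  [&& cubo_edge a b, (a, b) != (0, 11)%N & (a, b) != (11, 0)%N].

(** Reduces claims about ordinals to boolean checks on natural numbers, which evaluate. *)
Lemma iota_ord (n : nat) (P : pred nat) :
  all P (iota 0 n) -> forall a : 'I_n, P a.
Proof. by move=> /allP allP a; apply: allP; rewrite mem_iota /=. Qed.

Lemma iota_ord2 (n : nat) (P : rel nat) :
  all (fun a => all (P a) (iota 0 n)) (iota 0 n) -> forall a b : 'I_n, P a b.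
Proof. by move=> h a; exact: iota_ord (iota_ord h a). Qed.

Lemma cubo_sym : symmetric (fun a b : 'I_12 => cubo_edge a b).
Proof.
move=> a b; apply/eqP; move: a b.
by apply: (@iota_ord2 12 (fun a b => cubo_edge a b == cubo_edge b a)).
Qed.

Lemma cubo_irr : irreflexive (fun a b : 'I_12 => cubo_edge a b).
Proof.
move=> a; apply/negbTE; move: a.
by apply: (@iota_ord 12 (fun a => ~~ cubo_edge a a)).
Qed.

Definition cubo : sgraph := SGraph cubo_sym cubo_irr.

Lemma cubo_regular : regular 4 cubo.
Proof.
move=> a; rewrite -sum1_card big_mkcond /= (eq_bigr (fun b : 'I_12 =>
  (fun b => nat_of_bool (cubo_edge a b)) b)); last first.
  by move=> b _; rewrite inE; case: (cubo_edge _ _).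
rewrite -(big_mkord xpredT (fun b => nat_of_bool (cubo_edge a b))).
apply/eqP; move: a; apply: (@iota_ord 12
  (fun a => (\sum_(0 <= b < 12) cubo_edge a b)%N == 4%N)).
by rewrite /index_iota unlock.
Qed.

(** Four independent sets of three vertices, any two of which induce a star forest. *)
Definition cubo_colour (a : nat) : nat :=
  nth 0%N [:: 0; 1; 2; 3; 1; 3; 2; 0; 1; 3; 0; 2]%N a.

Lemma cubo_star_colourable : star_colourable 4 cubo.
Proof.
pose col (a : cubo) : 'I_4 := inord (cubo_colour a).
have col_val a : val (col a) = cubo_colour a.
  apply: inordK; move: a.
  by apply: (@iota_ord 12 (fun a => cubo_colour a < 4)%N).
exists col; split.
  move=> a b; rewrite -val_eqE !col_val; apply/implyP; move: a b.
  by apply: (@iota_ord2 12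
    (fun a b => cubo_edge a b ==> (cubo_colour a != cubo_colour b))).
move=> a [|b [|c [|d []]]] // _.
have check : all (fun a => all (fun b => cubo_edge a b ==>
    all (fun c => cubo_edge b c ==> all (fun d =>
      [&& cubo_edge c d & uniq [:: a; b; c; d]] ==>
      (2 < size (undup (map cubo_colour [:: a; b; c; d])))%N)
    (iota 0 12)) (iota 0 12)) (iota 0 12)) (iota 0 12) by vm_compute.
move=> /and4P[ab bc cd _] uni.
have uni' : uniq (map val [:: a; b; c; d]) by rewrite (map_inj_uniq val_inj).
have := implyP (iota_ord
  (implyP (iota_ord (implyP (iota_ord2 check a b) ab) c) bc) d).
move=> /(_ (introT andP (conj cd uni'))).
have -> : map cubo_colour [:: val a; val b; val c; val d] =
    map val (map col [:: a; b; c; d]) by rewrite /= !col_val.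
by rewrite (undup_map_inj val_inj) size_map.
Qed.

(** The group is $\mathbb{Z}/(t+1)$. One turn around the cycle [0, ..., 11] has total voltage 1, a
    generator, so this cycle lifts to a single cycle through all copies. For [t = 0] the cover is
    the cuboctahedron itself. *)
Definition cubo_voltage (t : nat) (a b : nat) : 'I_t.+1 :=
  if (a, b) == (11, 0)%N then inZp 1
  else if (a, b) == (0, 11)%N then - inZp 1 else 0.


Lemma cubo_voltageN (t : nat) (a b : cubo) :
  cubo_voltage t b a = - cubo_voltage t a b.
Proof.
rewrite /cubo_voltage !xpair_eqE.
have [/andP[/eqP-> /eqP->]|nba] :=
  boolP ((b == 11%N :> nat) && (a == 0%N :> nat)).
  by rewrite /= opprK.
rewrite (andbC (a == 11%N :> nat)) (andbC (a == 0%N :> nat)) (negPf nba).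
by case: ifP => // _; rewrite oppr0.
Qed.

Definition cubo_cover (t : nat) : sgraph :=
  voltage_graph (@cubo_voltageN t).

Lemma card_cubo_cover (t : nat) : #|cubo_cover t| = (12 * t.+1)%N.
Proof. by rewrite card_prod !card_ord mulnC. Qed.

Lemma cubo_cover_hamiltonian (t : nat) : hamiltonian (cubo_cover t).
Proof.
(* The lifted cycle: the quotient by 12 is the copy, the remainder the label. *)
pose g k : cubo_cover t := (inZp (k %/ 12), inZp (k %% 12)).
exists (mkseq g (12 * t.+1)); split.
- by rewrite size_mkseq; lia.
- apply/andP; split.
    apply: cycle_mkseq => [k|]; last first.
      rewrite /g mulKn// mulnC modnMl; congr pair; apply: val_inj => /=.
      by rewrite modnn mod0n.
    rewrite /edge /= /voltage_edge /= !modn_mod.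
    have [r11|rn11] := eqVneq (k %% 12)%N 11%N.
      have -> : (k.+1 %/ 12 = (k %/ 12).+1)%N by lia.
      have -> : (k.+1 %% 12 = 0)%N by lia.
      rewrite r11 /=; apply/eqP/val_inj.
      by rewrite /= modnDm addn1.
    have -> : (k.+1 %/ 12 = k %/ 12)%N by lia.
    have -> : (k.+1 %% 12 = (k %% 12).+1)%N by lia.
    have r_lt : (k %% 12 < 11)%N by lia.
    have -> : cubo_voltage t (k %% 12) (k %% 12).+1 = 0.
      rewrite /cubo_voltage !xpair_eqE (negPf rn11) /=.
      by case: eqP => // ->.
    rewrite addr0 eqxx andbT.
    by apply: (@iota_ord 11 (fun r => cubo_edge r r.+1) _ (Ordinal r_lt)).
  apply/mkseq_uniqP => j k; rewrite !inE => jn kn [].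
  rewrite !modn_mod => e1 e2; move: e1.
  rewrite !modn_small; try lia.
- move=> [i a]; apply/mapP; exists (12 * i + a)%N.
    rewrite mem_iota; have := ltn_ord i; have := ltn_ord a; lia.
  rewrite /g; congr pair; apply: val_inj => /=.
    rewrite modn_small; have := ltn_ord i; have := ltn_ord a; lia.
  have := ltn_ord a; lia.
Qed.

(** * Orientation tests and the drawing of one copy *)

Lemma line_separatedCl (u v x y : int * int) :
  line_separated u v x y -> line_separated v u x y.
Proof.
move=> [a [b [c [Lu Lv Lx Ly str]]]]; exists a, b, c; split=> //.
by case: str => [h|h|h]; [apply: Or32|apply: Or31|apply: Or33].
Qed.

Lemma line_separatedCr (u v x y : int * int) :
  line_separated u v x y -> line_separated u v y x.
Proof.
move=> [a [b [c [Lu Lv Lx Ly str]]]]; exists a, b, c; split=> //.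
by case: str => [h|h|[? ?]]; [apply: Or31|apply: Or32|apply: Or33].
Qed.

Definition hshift (d : int) (p : int * int) : int * int := (p.1 + d, p.2).

Lemma line_separated_shift (d : int) (u v x y : int * int) :
  line_separated u v x y ->
  line_separated (hshift d u) (hshift d v) (hshift d x) (hshift d y).
Proof.
move=> [a [b [c sep]]]; exists a, b, (c - a * d).
have LE p : linval a b (c - a * d) (hshift d p) = linval a b c p.
  by rewrite /linval /=; ring.
by rewrite !LE.
Qed.

(** Twice the signed area of the triangle [p q r], positive when [r] is to the left of the line from
    [p] to [q]. *)
Definition orient (p q r : int * int) : int :=
  (q.1 - p.1) * (r.2 - p.2) - (q.2 - p.2) * (r.1 - p.1).

(** A sufficient test: the only candidates for the separating line are the lines through the two
    segments, each in both directions. *)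
Definition orient_test (u v x y : int * int) : bool :=
  [|| [&& 0 <= orient x y u, 0 <= orient x y v &
        (0 < orient x y u) || (0 < orient x y v)],
      [&& 0 <= orient y x u, 0 <= orient y x v &
        (0 < orient y x u) || (0 < orient y x v)],
      (orient u v x < 0) && (orient u v y < 0) |
      (orient v u x < 0) && (orient v u y < 0)].

Lemma orient_test_separated (u v x y : int * int) :
  orient_test u v x y -> line_separated u v x y.
Proof.
have by_line p q : [/\ 0 <= orient p q u, 0 <= orient p q v,
    orient p q x <= 0, orient p q y <= 0
    & [\/ 0 < orient p q u, 0 < orient p q v
      | orient p q x < 0 /\ orient p q y < 0]] -> line_separated u v x y.
  have LE r : linval (p.2 - q.2) (q.1 - p.1)
      ((q.2 - p.2) * p.1 - (q.1 - p.1) * p.2) r = orient p q r.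
    by rewrite /linval /orient; ring.
  move=> sep; exists (p.2 - q.2), (q.1 - p.1).
  by exists ((q.2 - p.2) * p.1 - (q.1 - p.1) * p.2); rewrite !LE.
have orientl p q : orient p q p = 0 by rewrite /orient; ring.
have orientr p q : orient p q q = 0 by rewrite /orient; ring.
case/or4P => [/and3P[ou ov pos]|/and3P[ou ov pos]|/andP[ox oy]|/andP[ox oy]].
- apply: (by_line x y); rewrite orientl orientr; split=> //.
  by case/orP: pos => ?; [apply: Or31|apply: Or32].
- apply: (by_line y x); rewrite orientl orientr; split=> //.
  by case/orP: pos => ?; [apply: Or31|apply: Or32].
- apply: (by_line u v); rewrite orientl orientr.
  by split=> //; [exact: ltW|exact: ltW|apply: Or33].
- apply: (by_line v u); rewrite orientl orientr.
  by split=> //; [exact: ltW|exact: ltW|apply: Or33].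
Qed.

(* A straight-line drawing of the cuboctahedron minus the edge [0 -- 11], with
   these two vertices at the bottom left and bottom right corners. *)
Definition xcoord (a : nat) : nat :=
  nth 0%N [:: 0; 10; 8; 4; 3; 11; 7; 6; 8; 9; 10; 14]%N a.
Definition ycoord (a : nat) : nat :=
  nth 0%N [:: 1; 15; 9; 4; 2; 2; 3; 5; 4; 7; 4; 1]%N a.

(** [lo] and [hi] mark the first and the last copy, where vertex 0, respectively 11, drops from
    height 1 to 0. A single copy carries both marks. *)
Definition height (lo hi : bool) (a : nat) : nat :=
  ((ycoord a - (lo && (a == 0))) - (hi && (a == 11)))%N.

Definition copy_pos (lo hi : bool) (a : nat) : int * int :=
  ((xcoord a)%:Z, (height lo hi a)%:Z).

(* [if] rather than [==>], whose conclusion [vm_compute] would always evaluate. *)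
Definition copy_check (lo hi : bool) : bool :=
  all (fun a => all (fun b => if inner_edge a b then
    all (fun c => all (fun d =>
      if inner_edge c d && ~~ (((a == c) && (b == d)) || ((a == d) && (b == c)))
      then orient_test (copy_pos lo hi a) (copy_pos lo hi b)
             (copy_pos lo hi c) (copy_pos lo hi d)
      else true) (iota 0 12)) (iota 0 12) else true) (iota 0 12)) (iota 0 12).

Lemma copy_checkT (lo hi : bool) : copy_check lo hi.
Proof. by case: lo; case: hi; vm_compute. Qed.

Lemma copy_separated (lo hi : bool) (a b c d : 'I_12) :
  inner_edge a b -> inner_edge c d ->
  ~ ((a = c /\ b = d) \/ (a = d /\ b = c)) ->
  line_separated (copy_pos lo hi a) (copy_pos lo hi b)
    (copy_pos lo hi c) (copy_pos lo hi d).
Proof.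
move=> ab cd nsame; apply: orient_test_separated.
have := iota_ord2 (copy_checkT lo hi) a b; rewrite ab => h.
have := iota_ord2 h c d; rewrite cd /= ifT//.
apply/negP => /orP[] /andP[/eqP/val_inj e /eqP/val_inj e'].
  by apply: nsame; left.
by apply: nsame; right.
Qed.

(** * The drawing of the cover *)

(** A copy has width 14, so shifts by 15 leave gaps of width 1 for the edges between consecutive
    copies. *)
Definition cover_pos (t : nat) (u : cubo_cover t) : int * int :=
  hshift (15 * u.1)%:Z (copy_pos (u.1 == 0%N :> nat) (u.1 == t :> nat) u.2).

Lemma xcoord_le (a : 'I_12) : (xcoord a <= 14)%N.
Proof. by apply: (@iota_ord 12 (fun a => xcoord a <= 14)%N). Qed.

(** As [xcoord] is at most 14, the first coordinate determines the copy and [xcoord]; the height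
    separates vertices of a copy that share [xcoord]. *)
Lemma cover_pos_inj (t : nat) : injective (@cover_pos t).
Proof.
move=> [i a] [j b] [] /=; have := xcoord_le a; have := xcoord_le b => xb xa xe.
have /val_inj ij : nat_of_ord i = j by lia.
subst j; have {xe}xe : xcoord a = xcoord b by lia.
move=> he; congr pair; apply: val_inj; apply/eqP.
have check lo hi : all (fun a => all (fun b =>
    (xcoord a == xcoord b) && (height lo hi a == height lo hi b) ==> (a == b))
    (iota 0 12)) (iota 0 12) by case: lo; case: hi; vm_compute.
apply: (implyP (iota_ord2 (check _ _) a b)).
by rewrite xe eqxx /=; apply/eqP; exact: he.
Qed.

(* The vertical strips alternately contain a copy and the edge to the next. *)
Definition strip (k : nat) : nat := (15 * (k %/ 2) + 14 * (k %% 2))%N.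

(** Vertical segments are excluded because one on the boundary of a strip could overlap an edge of
    the next. *)
Definition in_strip (k : nat) (p q : int * int) : Prop :=
  [/\ (strip k)%:Z <= p.1 <= (strip k.+1)%:Z,
      (strip k)%:Z <= q.1 <= (strip k.+1)%:Z & p.1 != q.1].

(** The left boundary of the later strip separates, and [u v], not being vertical, has an endpoint
    strictly off it. *)
Lemma strip_separated (k l : nat) (u v x y : int * int) :
  k != l -> in_strip k u v -> in_strip l x y -> line_separated u v x y.
Proof.
move=> kl [/andP[u1 u2] /andP[v1 v2] nuv] [/andP[x1 x2] /andP[y1 y2] nxy].
have strip_homo m n : (m < n)%N -> (strip m.+1 <= strip n)%N.
  by rewrite /strip; lia.
case: (ltngtP k l) kl => // kl _.
- have h := strip_homo _ _ kl.
  exists (-1), 0, (strip l)%:Z; rewrite /linval; split; try lia.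
  case: (ltrP u.1 (strip l)%:Z) => h'; [apply: Or31|apply: Or32]; lia.
- have h := strip_homo _ _ kl.
  exists 1, 0, (- (strip k)%:Z); rewrite /linval; split; try lia.
  case: (ltrP (strip k)%:Z u.1) => h'; [apply: Or31|apply: Or32]; lia.
Qed.

(** If [x] and [y] are both above the axis, the axis separates. If one of them is on it, strictness
    at both fails; but that point is then an end of the bottom segment, and the line through [x] and
    [y] has the other end strictly on one side. *)
Lemma bottom_separated (m : int) (x y : int * int) :
  0 < m -> 0 <= x.2 -> 0 <= y.2 -> 0 < x.2 + y.2 ->
  (forall p, p = x \/ p = y -> p.2 = 0 -> p = (0, 0) \/ p = (m, 0)) ->
  line_separated (0, 0) (m, 0) x y.
Proof.
move=> m0 x0 y0 xy0 bot.
wlog x_le : x y x0 y0 xy0 bot / x.2 <= y.2.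
  move=> wl; case: (lerP x.2 y.2) => [|/ltW] xy; first exact: wl.
  apply: line_separatedCr; apply: wl => //; first by rewrite addrC.
  by move=> p /or_comm; apply: bot.
have [x2|nx2] := eqVneq x.2 0; last first.
  exists 0, (-1), 0; rewrite /linval /=; split; try lia.
  by apply: Or33; split; lia.
case: (bot x (or_introl erefl) x2) => ->.
- exists y.2, (- y.1), 0; rewrite /linval /=.
  have ym : 0 < y.2 * m by rewrite mulr_gt0//; lia.
  split; try lia.
  by apply: Or32; lia.
- exists (- y.2), (- (m - y.1)), (m * y.2); rewrite /linval /=.
  have ym : 0 < m * y.2 by rewrite mulr_gt0//; lia.
  split; try lia.
  by apply: Or31; lia.
Qed.

Definition jump (t : nat) (u v : cubo_cover t) : Prop :=
  [/\ u.2 = 11%N :> nat, v.2 = 0%N :> nat & v.1 = (u.1.+1 %% t.+1)%N :> nat].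

Lemma cover_edgeP (t : nat) (u v : cubo_cover t) :
  edge u v -> [\/ u.1 = v.1 /\ inner_edge u.2 v.2, jump u v | jump v u].
Proof.
have jumpP (u' v' : cubo_cover t) : edge u' v' ->
    (val u'.2, val v'.2) = (11, 0)%N -> jump u' v'.
  case: u' v' => [i a] [j b] /andP[_ /eqP/(congr1 val) /= jE] [aE bE].
  split=> //=; rewrite jE /cubo_voltage aE bE /= modnDmr addn1 //.
move=> uv.
have [e|n1] := eqVneq (val u.2, val v.2) (11, 0)%N.
  by apply: Or32; apply: jumpP.
have [e|n2] := eqVneq (val u.2, val v.2) (0, 11)%N.
  by apply: Or33; apply: jumpP; [rewrite edge_sym|case: e => ? ?; congr pair].
apply: Or31; case/andP: uv => uv /eqP ->.
rewrite /cubo_voltage (negPf n1) (negPf n2) addr0; split=> //.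
by apply/and3P; split.
Qed.

Lemma ycoord_gt0 (a : 'I_12) : (0 < ycoord a)%N &&
  ((a == 0%N :> nat) || (a == 11%N :> nat) || (1 < ycoord a)%N).
Proof.
by apply: (@iota_ord 12 (fun a => (0 < ycoord a)%N &&
  ((a == 0%N) || (a == 11%N) || (1 < ycoord a)%N))).
Qed.

(** Before lowering, all heights are at least 1, with equality only at 0 and 11, so only the two
    lowered corners reach height 0. *)
Lemma cover_pos_bottom (t : nat) (u : cubo_cover t) : (cover_pos u).2 = 0 ->
  cover_pos u = (0, 0) /\ u.2 = 0%N :> nat \/
  cover_pos u = ((15 * t + 14)%:Z, 0) /\ u.2 = 11%N :> nat.
Proof.
case: u => [i a]; rewrite /cover_pos /height /= => h.
have /andP[y0] := ycoord_gt0 a.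
case/orP => [/orP[]/eqP aE|y1]; last first.
  exfalso; move: h; rewrite /height; case: eqP; case: eqP; lia.
- right; split=> //; move: h; rewrite /hshift /copy_pos /height /= aE /=.
  rewrite andbF subn0; case: eqP => // -> _; congr pair.
  by rewrite /xcoord /=; lia.
- left; split=> //; move: h; rewrite /hshift /copy_pos /height /= aE /=.
  by rewrite andbF subn0; case: eqP => // -> _; congr pair.
Qed.

(** Heights are never negative, so the second condition says that the endpoints are not both on the
    bottom line; one may be. *)
Definition drawn_above (t k : nat) (u v : cubo_cover t) : Prop :=
  in_strip k (cover_pos u) (cover_pos v) /\
  0 < (cover_pos u).2 + (cover_pos v).2.

Lemma inner_above (t : nat) (u v : cubo_cover t) :
  u.1 = v.1 -> inner_edge u.2 v.2 -> drawn_above (2 * u.1) u v.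
Proof.
move: u v => [i a] [j b] /= <- ab.
have xne : xcoord a != xcoord b.
  move: ab; apply/implyP; apply: (@iota_ord2 12
    (fun a b => inner_edge a b ==> (xcoord a != xcoord b))).
  by vm_compute.
have := xcoord_le a; have := xcoord_le b => xb xa; split.
  by rewrite /in_strip /strip /=; split; lia.
rewrite lt_neqAle eq_sym addr_ge0// andbT.
(* Two endpoints at height 0 would give a loop or the cut edge 0 -- 11. *)
rewrite paddr_eq0//; apply/negP => /andP[/eqP/cover_pos_bottom h].
move=> /eqP/cover_pos_bottom h'.
case: h h' => [[pa ae]|[pa ae]] [[pb be]|[pb be]];
  move: ab; rewrite /= in ae be; by rewrite /inner_edge ae be.
Qed.

(** Neither endpoint is a lowered corner, so this edge is horizontal at height 1. *)
Lemma jump_above (t : nat) (u v : cubo_cover t) :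
  jump u v -> (u.1 < t)%N -> drawn_above (2 * u.1 + 1) u v.
Proof.
move: u v => [i a] [j b] [/= aE bE jE] it.
rewrite modn_small// in jE.
rewrite /drawn_above /in_strip /strip /cover_pos /= /height aE bE jE /=.
rewrite (ltn_eqF it) /=.
by rewrite /xcoord /ycoord !andbF /=; split; [split; lia|].
Qed.

Lemma drawn_aboveC (t k : nat) (u v : cubo_cover t) :
  drawn_above k u v -> drawn_above k v u.
Proof.
by move=> [[up vp uv] pos]; split; [split=> //; rewrite eq_sym|rewrite addrC].
Qed.

(** The parity of the strip is recorded because it tells what the strip holds: strip [2 * i] the
    inner edges of copy [i], strip [2 * i + 1] only the jump out of copy [i]. The last two cases are
    the edge closing the ring. *)
Lemma drawn_above_cases (t : nat) (u v : cubo_cover t) : edge u v ->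
  [\/ exists k, drawn_above k u v /\
        (if odd k then
           jump u v /\ val u.1 = k./2 \/ jump v u /\ val v.1 = k./2
         else [/\ val u.1 = k./2, val v.1 = k./2 & inner_edge u.2 v.2]),
      jump u v /\ val u.1 = t | jump v u /\ val v.1 = t].
Proof.
have jump_case (u' v' : cubo_cover t) : jump u' v' ->
    (drawn_above (2 * u'.1 + 1) u' v') \/ val u'.1 = t.
  move=> jmp; have [lt|ge] := ltnP u'.1 t; first by left; apply: jump_above.
  by right; apply/eqP; rewrite eqn_leq ge -ltnS ltn_ord.
have half_jump (i : nat) : odd (2 * i + 1) /\ (2 * i + 1)./2 = i by lia.
case/cover_edgeP => [[i_eq ab]|jmp|jmp].
- apply: Or31; exists (2 * u.1)%N; split; first exact: inner_above.
  by rewrite mul2n odd_double doubleK -i_eq.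
- case: (jump_case _ _ jmp) => h; last by apply: Or32.
  apply: Or31; exists (2 * u.1 + 1)%N; split=> //.
  by rewrite (half_jump _).1 (half_jump _).2; left.
- case: (jump_case _ _ jmp) => h; last by apply: Or33.
  apply: Or31; exists (2 * v.1 + 1)%N; split; first exact: drawn_aboveC.
  by rewrite (half_jump _).1 (half_jump _).2; right.
Qed.

Lemma jump_inj (t : nat) (u v x y : cubo_cover t) :
  jump u v -> jump x y -> val u.1 = val x.1 -> u = x /\ v = y.
Proof.
move: u v x y => [i a] [j b] [i' a'] [j' b'].
move=> [/= aE bE jE] [/= a'E b'E j'E] iE.
split; congr pair; apply: val_inj; rewrite /= ?aE ?bE ?a'E ?b'E//.
by rewrite jE j'E iE.
Qed.

Lemma last_jump_pos (t : nat) (u v : cubo_cover t) :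
  jump u v -> val u.1 = t ->
  cover_pos u = ((15 * t + 14)%:Z, 0) /\ cover_pos v = (0, 0).
Proof.
move: u v => [i a] [j b] [/= aE bE jE] it; rewrite it modnn in jE.
rewrite /cover_pos /= /hshift /copy_pos /height aE bE jE it /= eqxx !andbF.
by split; congr pair; rewrite /xcoord /=; lia.
Qed.

Lemma last_jump_separated (t k : nat) (u v x y : cubo_cover t) :
  jump u v -> val u.1 = t -> drawn_above k x y ->
  line_separated (cover_pos u) (cover_pos v) (cover_pos x) (cover_pos y).
Proof.
move=> jmp ut [_ xy]; have [-> ->] := last_jump_pos jmp ut.
apply: line_separatedCl; apply: bottom_separated => //; first by lia.
by move=> p [->|->] /cover_pos_bottom [[-> _]|[-> _]]; [left|right|left|right].
Qed.

(** [line_separated] is not symmetric. With the closing edge in second place the axis always serves,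
    since one endpoint of the other edge is strictly above it. *)
Lemma above_last_jump_separated (t k : nat) (u v x y : cubo_cover t) :
  jump u v -> val u.1 = t -> drawn_above k x y ->
  line_separated (cover_pos x) (cover_pos y) (cover_pos u) (cover_pos v).
Proof.
move=> jmp ut [_ xy]; have [-> ->] := last_jump_pos jmp ut.
have LE p : linval 0 1 0 p = p.2 by rewrite /linval; ring.
exists 0, 1, 0; rewrite !LE /=; split=> //.
have pos (a b : int) : 0 < a + b -> 0 < a \/ 0 < b by lia.
by case: (pos _ _ xy) => h; [apply: Or31|apply: Or32].
Qed.

Lemma cover_separated (t : nat) (u v x y : cubo_cover t) :
  edge u v -> edge x y -> ~ ((u = x /\ v = y) \/ (u = y /\ v = x)) ->
  line_separated (cover_pos u) (cover_pos v) (cover_pos x) (cover_pos y).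
Proof.
move=> /drawn_above_cases uvP /drawn_above_cases xyP nsame.
case: uvP => [[k [kuv uvE]]|[uv ut]|[vu vt]];
  case: xyP => [[l [lxy xyE]]|[xy xt]|[yx yt]].
- have [kl|kl] := eqVneq k l; last exact: strip_separated kl kuv.1 lxy.1.
  subst l; case: ifP uvE xyE => _.
    (* An odd strip holds a single edge, so the two edges coincide up to direction. *)
    case=> -[uv uE] [] [xy xE]; exfalso; apply: nsame.
    + by left; apply: jump_inj uv xy _; rewrite uE xE.
    + by right; apply: jump_inj uv xy _; rewrite uE xE.
    + by right; apply/and_comm; apply: jump_inj uv xy _; rewrite uE xE.
    + by left; apply/and_comm; apply: jump_inj uv xy _; rewrite uE xE.
  (* In an even strip both edges belong to one copy, and the computed check applies after a
     shift. *)
  move: u v x y {kuv lxy} nsame => [i a] [i1 b] [i2 c] [i3 d] nsame.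
  move=> [/= iE i1E ab] [i2E i3E cd].
  have e1 : i1 = i by apply: val_inj; rewrite /= i1E iE.
  have e2 : i2 = i by apply: val_inj; rewrite /= i2E iE.
  have e3 : i3 = i by apply: val_inj; rewrite /= i3E iE.
  subst i1 i2 i3; apply: line_separated_shift; apply: copy_separated => //.
  by move=> /= abcd; apply: nsame; case: abcd => -[-> ->]; [left|right].
- exact: above_last_jump_separated xy xt kuv.
- apply: line_separatedCr; exact: above_last_jump_separated yx yt kuv.
- exact: last_jump_separated uv ut lxy.
(* Both edges close the ring, hence are equal; the other direction cases below are alike. *)
- by exfalso; apply: nsame; left; apply: jump_inj uv xy _; rewrite ut xt.
- by exfalso; apply: nsame; right; apply: jump_inj uv yx _; rewrite ut yt.
- apply: line_separatedCl; exact: last_jump_separated vu vt lxy.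
- exfalso; apply: nsame; right; apply/and_comm.
  by apply: jump_inj vu xy _; rewrite vt xt.
- exfalso; apply: nsame; left; apply/and_comm.
  by apply: jump_inj vu yx _; rewrite vt yt.
Qed.

(** * Assembling the properties of the covers *)

Lemma cubo_cover_regular (t : nat) : regular 4 (cubo_cover t).
Proof. exact: (@voltage_regular _ _ _ (@cubo_voltageN t)) cubo_regular. Qed.

Lemma cubo_cover_planar (R : realType) (t : nat) : planar R (cubo_cover t).
Proof.
apply: (@straight_line_planar R _ (@cover_pos t)).
- exact: cover_pos_inj.
- move=> u; have [v uv] : exists v, v \in [pred w | edge u w].
    by apply/card_gt0P; rewrite cubo_cover_regular.
  by exists v.
- exact: cover_separated.
Qed.

Local Close Scope ring_scope.

Theorem theorem6 (R : realType) (n : nat) (n_gt0 : 0 < n) (n_dvd12 : 12 %| n) :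
  exists G : sgraph,
    [/\ #|G| = n, planar R G, regular 4 G, hamiltonian G
      & star_colourable 4 G].
Proof.
case/dvdnP: n_dvd12 n_gt0 => -[|t] -> n_gt0; first by [].
exists (cubo_cover t); split.
- by rewrite card_cubo_cover mulnC.
- exact: cubo_cover_planar.
- exact: cubo_cover_regular.
- exact: cubo_cover_hamiltonian.
- exact: voltage_star_colourable cubo_star_colourable.
Qed.
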